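(* Let $\mathcal{L}$ be a lattice and $\{a_I\}_{I\in\mathcal{L}}$ real numbers such that $\{|a_I|\}_{I\in\mathcal{L}}$ is a Carleson sequence, and suppose the balayage $g=\sum_{I\in\mathcal{L}}\frac{1}{|I|}\mathbf{1}_Ia_I$ is well defined, i.e. $\sum_{I\in\mathcal{L}}\frac{1}{|I|}\mathbf{1}_I|a_I|$ is finite a.e. and locally integrable. Then $g$ belongs to martingale BMO and $$\|g\|_{\mathrm{BMO}}\le 2\,\mathrm{Carl}(|a_I|).$$
   Context: Work on $\mathbb{R}$ with Lebesgue measure. A lattice $\mathcal{L}$ is a collection of nondegenerate finite intervals of $\mathbb{R}$ which is a union of generations $\mathcal{L}_k$, $k\in\mathbb{Z}$, each $\mathcal{L}_k$ a collection of pairwise disjoint intervals covering $\mathbb{R}$, with every $I\in\mathcal{L}_k$ a finite disjoint union of intervals of $\mathcal{L}_{k+1}$ (possibly of $I$ alone). For $I\in\mathcal{L}$ with $\mathrm{rk}(I)=k$ (the largest $k$ with $I\in\mathcal{L}_k$), $\mathrm{child}(I)$ is the set of $J\in\mathcal{L}_{k+1}$ with $J\subseteq I$. $\mathfrak{A}_{-\infty}^{0,\mathrm{fin}}$ is the collection of sets $\bigcup_kI_k$ ($I_k\in\mathcal{L}_k$, $I_k\subseteq I_{k-1}$) of finite measure. $\langle f\rangle_I=\frac1{|I|}\int_If$, $\mathbb{E}_If=\langle f\rangle_I\mathbf{1}_I$, $\Delta_If=-\mathbb{E}_If+\sum_{J\in\mathrm{child}(I)}\mathbb{E}_Jf$.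 A sequence of nonnegative numbers $\{b_I\}_{I\in\mathcal{L}}$ is a Carleson sequence if there is $C>0$ with $\frac1{|I|}\sum_{J\in\mathcal{L},J\subseteq I}b_J\le C$ for every $I\in\mathcal{L}\cup\mathfrak{A}_{-\infty}^{0,\mathrm{fin}}$; $\mathrm{Carl}(b_I)$ is the infimum of such $C$. A locally integrable $g$ is in martingale BMO if $C_1=\sup_{I\in\mathcal{L}}\big[\frac1{|I|}\int_I\sum_{J\in\mathcal{L},J\subseteq I}|\Delta_Jg|^2\big]^{1/2}<\infty$ and $C_2=\sup_{I\in\mathcal{L}}\|\Delta_Ig\|_\infty<\infty$; then $\|g\|_{\mathrm{BMO}}=\max\{C_1,C_2\}$. *)

(* Defs.v *)
From HB Require Import structures.
From mathcomp Require Import all_boot all_order all_algebra.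
From mathcomp Require Import all_classical all_reals all_analysis ess_sup_inf measurable_realfun.
Set Implicit Arguments. Unset Strict Implicit. Unset Printing Implicit Defensive.
Import Order.TTheory GRing.Theory Num.Theory.
Import numFieldNormedType.Exports.
Local Open Scope classical_set_scope.
Local Open Scope ring_scope.

Section defs.
Context {R : realType}.
Local Notation mu := (@lebesgue_measure R).

Definition nd_interval (A : set R) : Prop :=
  exists a b : R, a < b /\
    (A = `[a, b]%classic \/ A = `]a, b]%classic \/
     A = `[a, b[%classic \/ A = `]a, b[%classic).

(* a lattice given by its generations L_k, k : int *)
Definition is_lattice (L : int -> set (set R)) : Prop :=
  [/\ (forall k I, L k I -> nd_interval I),
      (forall k I J, L k I -> L k J -> I <> J -> I `&` J = set0),
      (forall k (x : R), exists I, L k I /\ I x) &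
      (forall k I, L k I -> exists F : set (set R),
          [/\ finite_set F, F `<=` L (k + 1)%R & I = \bigcup_(J in F) J])].

Definition inL (L : int -> set (set R)) (I : set R) : Prop := exists k, L k I.

Definition is_rank (L : int -> set (set R)) (I : set R) (k : int) : Prop :=
  L k I /\ forall m, L m I -> (m <= k)%R.

(* child(I); convention: if no largest k exists (I is never subdivided),
   child(I) = {I} *)
Definition child (L : int -> set (set R)) (I : set R) : set (set R) :=
  [set J | (exists k, is_rank L I k /\ L (k + 1)%R J /\ J `<=` I) \/
           ((forall k, ~ is_rank L I k) /\ J = I)].

Definition inA (L : int -> set (set R)) (A : set R) : Prop :=
  exists Ik : int -> set R,
    [/\ (forall k, L k (Ik k)), (forall k, Ik k `<=` Ik (k - 1)%R),
        A = \bigcup_k Ik k & (mu A < +oo)%E].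

Definition len (I : set R) : R := fine (mu I).

Definition carleson_bound (L : int -> set (set R)) (b : set R -> R) (C : R) :=
  forall I, inL L I \/ inA L I ->
    ((len I)^-1%:E * (\esum_(J in [set J | inL L J /\ J `<=` I]) (b J)%:E)
      <= C%:E)%E.

Definition carleson_seq (L : int -> set (set R)) (b : set R -> R) : Prop :=
  (forall I, inL L I -> 0 <= b I) /\ exists C, 0 < C /\ carleson_bound L b C.

Definition Carl (L : int -> set (set R)) (b : set R -> R) : R :=
  inf [set C | 0 < C /\ carleson_bound L b C].

Definition avg (f : R -> R) (I : set R) : R :=
  (len I)^-1 * fine (\int[mu]_(x in I) (f x)%:E)%E.

Definition EI (f : R -> R) (I : set R) (x : R) : R := avg f I * \1_I x.

Definition Delta (L : int -> set (set R)) (f : R -> R) (I : set R) (x : R) : R :=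
  - EI f I x + \sum_(J \in child L I) EI f J x.

Definition bmo_C1 (L : int -> set (set R)) (g : R -> R) : \bar R :=
  ereal_sup [set sqrte ((len I)^-1%:E *
     (\int[mu]_(x in I) \esum_(J in [set J | inL L J /\ J `<=` I])
                          ((Delta L g J x) ^+ 2)%:E))%E | I in inL L].

Definition bmo_C2 (L : int -> set (set R)) (g : R -> R) : \bar R :=
  ereal_sup [set ess_sup mu (fun x => (`|Delta L g I x|)%:E) | I in inL L].

Definition in_BMO (L : int -> set (set R)) (g : R -> R) : Prop :=
  (bmo_C1 L g < +oo)%E /\ (bmo_C2 L g < +oo)%E.

Definition bmo_norm (L : int -> set (set R)) (g : R -> R) : \bar R :=
  Order.max (bmo_C1 L g) (bmo_C2 L g).

Definition balayage_abs (L : int -> set (set R)) (a : set R -> R) (x : R) : \bar R :=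
  \esum_(I in inL L) ((len I)^-1 * `|a I| * \1_I x)%:E.

Definition balayage (L : int -> set (set R)) (a : set R -> R) (x : R) : R :=
  fine (\esum_(I in inL L) ((len I)^-1 * Num.max (a I) 0 * \1_I x)%:E)
  - fine (\esum_(I in inL L) ((len I)^-1 * Num.max (- a I) 0 * \1_I x)%:E).

(* local integrability of a nonnegative extended function *)
Definition loc_integrable (f : R -> \bar R) : Prop :=
  measurable_fun [set: R] f /\
  forall K : set R, compact K -> (\int[mu]_(x in K) f x < +oo)%E.

End defs.

(* Main.v *)
Require Import Defs.
From HB Require Import structures.
From mathcomp Require Import all_boot all_order all_algebra.
From mathcomp Require Import all_classical all_reals all_analysis.
From mathcomp Require Import ess_sup_inf measurable_realfun.
From mathcomp Require Import ring lra.
Set Implicit Arguments. Unset Strict Implicit. Unset Printing Implicit Defensive.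
Import Order.TTheory GRing.Theory Num.Theory.
Local Open Scope classical_set_scope.
Local Open Scope ring_scope.

(* Write [C] for the Carleson constant, [s_J] for the sum of [a_K] over [K] inside
   [J], and [A_J] for the same sum of [|a_K|], so that [|s_J| <= A_J <= C |J|].
   The intervals containing [J] contribute a constant to the balayage on [J];
   hence [<g>_J] is this constant plus [s_J / |J|], and for a child [K] of [J]
   the martingale difference on [K] is
     [<g>_K - <g>_J = s_K / |K| - (s_J - a_J) / |J|],
   where both terms are at most [C] in absolute value. For the square function,
     [B_J = C^2 |J| - s_J^2 / |J| + 2 C A_J]
   satisfies [||Delta_J g||_2^2 + sum_K B_K <= B_J] (sum over the children [K]),
   so the squared norms of the differences inside [I] add up to at most
   [B_I <= 3 C^2 |I|]: no orthogonality or [L^2] bound on [g] is needed. *)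

(** * Unordered sums *)

Section esum_complements.
Context {R : realType}.

Lemma esum_trivIset_bigcup (I T : choiceType) (D : set I) (J : I -> set T)
    (a : T -> \bar R) :
  trivIset D J -> (forall x, (0 <= a x)%E) ->
  (\esum_(x in \bigcup_(i in D) J i) a x = \esum_(i in D) \esum_(x in J i) a x)%E.
Proof.
move=> tJ a0; rewrite (@esum_esum _ _ _ D J (fun _ x => a x))//.
rewrite (reindex_esum (D `*`` J) _ snd)//; split.
- by move=> [i x] [/= Di Jx]; exists i.
- move=> [i x] [j y] /set_mem[/= Di Jx] /set_mem[/= Dj Jy] /= xy; subst y.
  by congr pair; apply: (tJ i j Di Dj); exists x.
- by move=> x [i Di Jx]; exists (i, x).
Qed.

Lemma esum_setU (T : choiceType) (A B : set T) (a : T -> \bar R) :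
  A `&` B = set0 -> (forall x, (0 <= a x)%E) ->
  (\esum_(x in A `|` B) a x = \esum_(x in A) a x + \esum_(x in B) a x)%E.
Proof.
move=> AB a0; rewrite (esumID A)//; congr (_ + _)%E; congr esum.
  by rewrite setIC setIUr setIid AB setU0.
rewrite setIUl setICr set0U; apply/setIidPl => x Bx Ax.
by have : (A `&` B) x by []; rewrite AB.
Qed.

(** The enumeration [e] is chosen before [a], so a single one serves all points [x] of a family of
    functions at once; sums of functions become series, to which monotone convergence applies. *)
Lemma countable_esum_eseries (T : pointedType) (A : set T) :
  countable A -> exists (e : nat -> T) (B : set nat), B `<=` e @^-1` A /\
    forall a : T -> \bar R, (forall x, (0 <= a x)%E) ->
    (\esum_(x in A) a x = \sum_(0 <= n <oo) (if n \in B then a (e n) else 0))%E.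
Proof.
move=> /countable_bijP[B]; rewrite card_eq_sym => /pcard_eqP[e].
have eb : set_bij B A e by exact: bij.
exists e, B; split=> [n Bn|a a0]; first by case: eb => /(_ _ Bn).
rewrite (reindex_esum B _ e)// -eseries_mkcond nneseries_esum//.
by congr esum; apply/seteqP; split=> n /=; rewrite inE.
Qed.

(** * Measurability and termwise integration of countable sums *)

Section integral.
Context d (T : measurableType d) (mu : {measure set T -> \bar R}).
Context (I : pointedType) (A : set I) (D : set T) (f : I -> T -> \bar R).
Hypotheses (cA : countable A) (mD : measurable D).
Hypotheses (mf : forall i, A i -> measurable_fun D (f i)).
Hypotheses (f0 : forall i x, (0 <= f i x)%E).

Lemma ge0_measurable_esum : measurable_fun D (fun x => \esum_(i in A) f i x)%E.
Proof.
have [e [B [BA eB]]] := countable_esum_eseries cA.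
under eq_fun do rewrite eB//.
apply: ge0_emeasurable_sum => n; first by move=> x Dx _; case: ifPn.
by have [/set_mem/BA/mf|] := boolP (n \in B).
Qed.

Lemma ge0_integral_esum :
  (\int[mu]_(x in D) (\esum_(i in A) f i x) =
   \esum_(i in A) (\int[mu]_(x in D) f i x))%E.
Proof.
have [e [B [BA eB]]] := countable_esum_eseries cA.
under eq_integral do rewrite eB//.
rewrite integral_nneseries//; last 2 first.
- by move=> n; have [/set_mem/BA/mf|] := boolP (n \in B).
- by move=> n x _; case: ifPn.
rewrite eB; last by move=> i; exact: integral_ge0.
by apply: eq_eseriesr => n _; case: (n \in B); rewrite ?integral0.
Qed.

End integral.
End esum_complements.

(** * Lattices *)

Section intervals.
Context {R : realType}.
Local Notation mu := (@lebesgue_measure R).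

Lemma nd_intervalP (A : set R) : nd_interval A ->
  [/\ measurable A, mu A = (len A)%:E, 0 < len A &
      exists a b, a < b /\ `]a, b[ `<=` A].
Proof.
move=> [a [b [ab]]].
have h (i : interval R) : (mu [set` i] = (b - a)%:E)%E -> `]a, b[ `<=` [set` i] ->
    [/\ measurable [set` i], mu [set` i] = (len [set` i])%:E, 0 < len [set` i] &
      exists a b, a < b /\ `]a, b[ `<=` [set` i]].
  move=> mi si; split; [exact: measurable_itv | by rewrite /len mi | | by exists a, b].
  by rewrite /len mi /= subr_gt0.
by case=> [|[|[|]]] ->; apply: h; rewrite ?lebesgue_measure_itv/= ?lte_fin ?ab //;
  apply: subset_itv; rewrite bnd_simp.
Qed.

Lemma nd_interval_nonempty (A : set R) : nd_interval A -> exists x, A x.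
Proof.
move=> /nd_intervalP[_ _ _ [a [b [ab abA]]]].
exists ((a + b) / 2); apply: abA => /=.
by rewrite in_itv/= !midf_lt.
Qed.

Lemma nd_interval_rat (A : set R) : nd_interval A -> exists q : rat, A (ratr q).
Proof.
move=> /nd_intervalP[_ _ _ [a [b [ab abA]]]].
have [q qab] := rat_in_itvoo ab.
by exists q; apply: abA.
Qed.

End intervals.

Section lattice.
Context {R : realType} (L : int -> set (set R)) (latL : is_lattice L).
Local Notation mu := (@lebesgue_measure R).
Implicit Types (I J K : set R) (k m : int).

Lemma gen_nd k I : L k I -> nd_interval I.
Proof. by case: latL => h _ _ _; exact: h. Qed.

Lemma inL_nd I : inL L I -> nd_interval I.
Proof. by move=> [k]; exact: gen_nd. Qed.

Lemma gen_eq k I J x : L k I -> L k J -> I x -> J x -> I = J.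
Proof.
case: latL => _ h _ _ LI LJ Ix Jx; apply: contrapT => /(h _ _ _ LI LJ) IJ.
by have : (I `&` J) x by []; rewrite IJ.
Qed.

Lemma gen_step k I x : L k I -> I x -> exists J, [/\ L (k + 1) J, J `<=` I & J x].
Proof.
case: latL => _ _ _ h /h[F [_ FL ->]] [J FJ Jx].
by exists J; split=> //; [exact: FL | exact: bigcup_sup].
Qed.

(** Induction on [m - k]: the common point [x] selects one interval in each generation from [k] to
    [m], each inside the previous one, and the last of them is [J]. *)
Lemma gen_sub k m I J x : (k <= m)%R -> L k I -> L m J -> I x -> J x -> J `<=` I.
Proof.
rewrite -subr_ge0 => km; have [n mkn] : exists n : nat, (m = k + n%:Z)%R.
  by exists `|m - k|%N; rewrite gez0_abs// subrKC.
move: mkn => -> {km m}; elim: n => [|n IH] in k I *.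
  by rewrite addr0 => LI LJ Ix Jx; rewrite (gen_eq LI LJ Ix Jx).
move=> LI LJ Ix Jx; have [I' [LI' I'I I'x]] := gen_step LI Ix.
apply: subset_trans I'I; apply: IH LI' _ I'x Jx.
by rewrite -addrA -intS.
Qed.

Lemma inL_nested I J x : inL L I -> inL L J -> I x -> J x -> I `<=` J \/ J `<=` I.
Proof.
move=> [k LI] [m LJ] Ix Jx; have [km|mk] := leP k m.
  by right; exact: gen_sub km LI LJ Ix Jx.
by left; exact: gen_sub (ltW mk) LJ LI Jx Ix.
Qed.

(** The interval of generation [k + 1] around a point of [I] lies inside [I] and, as [k + 1 <= m],
    also contains [I]. Hence the generations of an interval have no gaps. *)
Lemma gen_succ k m I : L k I -> L m I -> (k < m)%R -> L (k + 1) I.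
Proof.
move=> kI mI km; have [x Ix] := nd_interval_nonempty (gen_nd kI).
have [J [LJ JI Jx]] := gen_step kI Ix.
suff -> : I = J by [].
apply/seteqP; split=> //; apply: gen_sub LJ mI Jx Ix.
by rewrite lezD1.
Qed.

Lemma gen_rank k I : L k I -> ~ L (k + 1) I -> is_rank L I k.
Proof.
move=> kI nkI; split=> // m mI; rewrite leNgt; apply/negP => km.
exact/nkI/(gen_succ kI mI).
Qed.

Lemma rank_uniq I k m : is_rank L I k -> is_rank L I m -> k = m.
Proof. by move=> [Ik hk] [Im hm]; apply/eqP; rewrite eq_le hk// hm. Qed.

Lemma childE I k : is_rank L I k -> child L I = [set J | L (k + 1) J /\ J `<=` I].
Proof.
move=> Ik; apply/seteqP; split=> J.
  move=> [[m [/(rank_uniq Ik)<-]]//|[/(_ k)]//].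
by move=> [LJ JI]; left; exists k.
Qed.

Lemma child_rankless I : (forall k, ~ is_rank L I k) -> child L I = [set I].
Proof.
move=> Ik; apply/seteqP; split=> J.
  by move=> [[m [/Ik]]//|[]].
by move=> ->; right.
Qed.

(** * Children of an interval that has a rank *)

Section ranked.
Context I k (Ik : is_rank L I k).

Lemma rank_inL : inL L I. Proof. by exists k; case: Ik. Qed.

Lemma child_inL J : child L I J -> inL L J.
Proof. by rewrite (childE Ik) => -[LJ _]; exists (k + 1)%R. Qed.

Lemma child_sub J : child L I J -> J `<=` I.
Proof. by rewrite (childE Ik) => -[]. Qed.

Lemma child_neq J : child L I J -> J <> I.
Proof.
rewrite (childE Ik) => -[LJ _] JI; case: Ik => _ /(_ _ _)/=; subst J => /(_ _ LJ).
by rewrite leNgt ltzD1 lexx.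
Qed.

Lemma child_eq J K x : child L I J -> child L I K -> J x -> K x -> J = K.
Proof. by rewrite (childE Ik) => -[LJ _] [LK _]; exact: gen_eq LJ LK. Qed.

Lemma trivIset_child : trivIset (child L I) id.
Proof. by move=> J K cJ cK [x [Jx Kx]]; exact: child_eq cJ cK Jx Kx. Qed.

Lemma bigcup_child : \bigcup_(J in child L I) J = I.
Proof.
apply/seteqP; split=> [x [J /child_sub]|x Ix]; first exact.
have [J [LJ JI Jx]] := gen_step Ik.1 Ix.
by exists J => //; rewrite (childE Ik).
Qed.

Lemma finite_child : finite_set (child L I).
Proof.
case: latL => _ _ _ /(_ _ _ Ik.1)[F [fF FL IF]].
apply: sub_finite_set fF => J cJ.
have [x Jx] := nd_interval_nonempty (inL_nd (child_inL cJ)).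
have := child_sub cJ Jx; rewrite {1}IF => -[K FK Kx].
suff -> : J = K by [].
move: cJ; rewrite (childE Ik) => -[LJ _].
exact: gen_eq LJ (FL _ FK) Jx Kx.
Qed.

Lemma inL_sub_child J : inL L J -> J `<=` I -> J <> I ->
  exists2 K, child L I K & J `<=` K.
Proof.
move=> [m LJ] JI neJI; have [x Jx] := nd_interval_nonempty (gen_nd LJ).
have [K [LK KI Kx]] := gen_step Ik.1 (JI _ Jx).
exists K; first by rewrite (childE Ik).
have [mk|km] := leP m k; last by apply: gen_sub LK LJ Kx Jx; rewrite lezD1.
by exfalso; apply/neJI/seteqP; split=> //; exact: gen_sub mk LJ Ik.1 Jx (JI _ Jx).
Qed.

(** No interval of the lattice lies strictly between a child and its parent: an interval strictly
    inside [I] is contained in a single child, which here can only be [K]. *)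
Lemma child_inL_sup K J : child L I K -> inL L J -> K `<=` J -> J <> K -> I `<=` J.
Proof.
move=> cK LJ KJ JK.
have [x Kx] := nd_interval_nonempty (inL_nd (child_inL cK)).
have [//|JI] := inL_nested rank_inL LJ (child_sub cK Kx) (KJ _ Kx).
have [->//|neJI] := pselect (J = I).
have [K' cK' JK'] := inL_sub_child LJ JI neJI.
exfalso; apply: JK; apply/seteqP; split=> //.
by rewrite (child_eq cK cK' Kx (JK' _ (KJ _ Kx))).
Qed.

Lemma mu_child : (mu I = \sum_(K \in child L I) (len K)%:E)%E.
Proof.
rewrite -{1}bigcup_child measure_fin_bigcup//.
- apply: eq_fsbigr => K /set_mem cK.
  by have [_ ] := nd_intervalP (inL_nd (child_inL cK)).
- exact: finite_child.
- exact: trivIset_child.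
- by move=> K cK; have [] := nd_intervalP (inL_nd (child_inL cK)).
Qed.

Lemma len_child : len I = \sum_(K \in child L I) len K.
Proof. by rewrite {1}/len mu_child fsumEFin//; exact: finite_child. Qed.

End ranked.

(** * Intervals of the lattice below and above a given one *)

Definition under I : set (set R) := [set J | inL L J /\ J `<=` I].
(** Strict, whereas [under] is not: for [I] in the lattice, nestedness puts every lattice interval
    that meets [I] in exactly one of [under I] and [above I]. *)
Definition above I : set (set R) := [set J | [/\ inL L J, I `<=` J & J <> I]].

Lemma under_ranked I k : is_rank L I k ->
  under I = [set I] `|` \bigcup_(K in child L I) under K.
Proof.
move=> Ik; apply/seteqP; split=> J.
  move=> [LJ JI]; have [->|neJI] := pselect (J = I); first by left.
  by right; have [K cK JK] := inL_sub_child Ik LJ JI neJI; exists K.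
move=> [->|[K cK [LJ JK]]]; first by split=> //; exact: rank_inL Ik.
by split=> //; exact: subset_trans JK (child_sub Ik cK).
Qed.

Lemma trivIset_under_child I k : is_rank L I k -> trivIset (child L I) under.
Proof.
move=> Ik J K cJ cK [M [[LM MJ] [_ MK]]].
have [x Mx] := nd_interval_nonempty (inL_nd LM).
exact: (child_eq Ik) cJ cK (MJ _ Mx) (MK _ Mx).
Qed.

Lemma notin_under_child I k : is_rank L I k ->
  [set I] `&` \bigcup_(K in child L I) under K = set0.
Proof.
move=> Ik; rewrite -subset0 => J [-> [K cK [_ IK]]].
by apply: (child_neq Ik cK); apply/seteqP; split=> //; exact: (child_sub Ik).
Qed.

Lemma esum_under_ranked I k (v : set R -> \bar R) :
  is_rank L I k -> (forall J, 0 <= v J)%E ->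
  (\esum_(J in under I) v J =
   v I + \sum_(K \in child L I) \esum_(J in under K) v J)%E.
Proof.
move=> Ik v0; rewrite (under_ranked Ik) esum_setU//; last exact: notin_under_child Ik.
rewrite esum_set1// esum_trivIset_bigcup//; last exact: trivIset_under_child Ik.
rewrite esum_fset//; first exact: (finite_child Ik).
by move=> K _; exact: esum_ge0.
Qed.

Lemma above_child I k K : is_rank L I k -> child L I K -> above K = [set I] `|` above I.
Proof.
move=> Ik cK; apply/seteqP; split=> J.
  move=> [LJ KJ neJK]; have [->|neJI] := pselect (J = I); first by left.
  by right; split=> //; exact: (child_inL_sup Ik) cK LJ KJ neJK.
have KI := child_sub Ik cK; have neKI := child_neq Ik cK.
move=> [->|[LJ IJ neJI]]; split=> //.
- exact: rank_inL Ik.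
- exact: nesym.
- exact: subset_trans IJ.
- by move=> JK; apply: neKI; apply/seteqP; split=> //; rewrite -JK.
Qed.

Lemma above_notin I : [set I] `&` above I = set0.
Proof. by rewrite -subset0 => J [-> []]. Qed.

(** The intervals of one generation are disjoint and each contains a rational, so a choice of
    rationals is injective on the generation. *)
Lemma countable_inL : countable (inL L).
Proof.
have -> : inL L = \bigcup_k L k by apply/seteqP; split=> I; [move=> [k]|move=> [k _]]; exists k.
apply: bigcup_countable => // k _; apply/countable_injP.
have /choice[q qP] : forall I, exists q : rat, L k I -> I (ratr q).
  move=> I; have [LI|] := pselect (L k I); last by exists 0.
  by have [q] := nd_interval_rat (gen_nd LI); exists q.
exists (fun I => pickle (q I)) => I J /set_mem LI /set_mem LJ /(pcan_inj pickleK) IJ.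
by apply: (gen_eq LI LJ (qP _ LI)); rewrite IJ; exact: qP.
Qed.

Lemma countable_under I : countable (under I).
Proof. by apply: sub_countable countable_inL; apply: subset_card_le => J []. Qed.

(* The Bellman function principle: [B] is a supersolution on the tree below [I].
   Intervals without rank are their own child, whence the condition [v J = 0]. *)
Lemma esum_under_le (v B : set R -> \bar R) I :
  (forall J, 0 <= v J)%E -> (forall J, inL L J -> 0 <= B J)%E ->
  (forall J, inL L J -> (forall k, ~ is_rank L J k) -> v J = 0)%E ->
  (forall J k, is_rank L J k -> v J + \sum_(K \in child L J) B K <= B J)%E ->
  inL L I -> (\esum_(J in under I) v J <= B I)%E.
Proof.
move=> v0 B0 vrl step LI.
(* The tree below [I] cut after [n] generations: an interval counts when its rank is less than
   [k + n]. Intervals without rank are left out, as [v] vanishes on them. *)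
pose X n k I := [set J | J `<=` I /\ exists j, (j < k + n%:Z)%R /\ is_rank L J j].
have XB n : forall k I, L k I -> (\esum_(J in X n k I) v J <= B I)%E.
  elim: n => [|n IH] k {LI}I LI.
    (* For [n = 0] the set is empty: a [J] inside [I] of rank below [k] would equal [I], which has
       generation [k]. *)
    rewrite (_ : X _ _ _ = set0) ?esum_set0; first by apply: B0; exists k.
    rewrite -subset0 => J [JI [j [+ Jj]]]; rewrite addr0 => jk.
    have [x Jx] := nd_interval_nonempty (gen_nd Jj.1).
    have IJ := gen_sub (ltW jk) Jj.1 LI Jx (JI _ Jx).
    have {}IJ : I = J by apply/seteqP.
    by move: Jj LI => [_ + LI]; rewrite -IJ => /(_ _ LI); rewrite leNgt jk.
  have kn : (k + n.+1%:Z = k + 1 + n%:Z)%R by rewrite -addrA -intS.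
  (* If [I] persists into generation [k + 1], one generation is used up with no change to the set;
     otherwise [k] is its rank, and the induction hypothesis applies to its children. *)
  have [LI1|nLI1] := pselect (L (k + 1) I).
    by rewrite (_ : X _ _ _ = X n (k + 1)%R I) ?IH// /X kn.
  have Ik := gen_rank LI nLI1.
  apply: le_trans (step _ _ Ik).
  apply: (@le_trans _ _ (\esum_(J in [set I] `|` \bigcup_(K in child L I) X n (k + 1)%R K) v J)).
    rewrite [leLHS]esum_mkcond [leRHS]esum_mkcond; apply: le_esum => J _.
    case: ifPn => [/set_mem[JI [j [jn Jj]]]|_]; last by case: ifPn.
    rewrite mem_set//; have [->|neJI] := pselect (J = I); first by left.
    have [K cK JK] := inL_sub_child Ik (rank_inL Jj) JI neJI.
    by right; exists K => //; split=> //; exists j; rewrite -kn.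
  have XU K : X n (k + 1)%R K `<=` under K.
    by move=> J [JK [j [_ Jj]]]; split=> //; exact: rank_inL Jj.
  rewrite esum_setU//; last first.
    rewrite -subset0 -(notin_under_child Ik); apply: setIS.
    by apply: subset_bigcup => K _; exact: XU.
  rewrite esum_set1//; apply: leeD2l.
  rewrite esum_trivIset_bigcup//; last first.
    move=> J K cJ cK [M [MJ MK]]; apply: (trivIset_under_child Ik cJ cK).
    by exists M; split; exact: XU.
  rewrite -esum_fset; [|exact: (finite_child Ik)|]; last first.
    by move=> K /set_mem cK; apply/B0/(child_inL Ik).
  apply: le_esum => K; rewrite (childE Ik) => -[LK _]; exact: IH.
(* An unordered sum is a supremum over finite sets [F], and the ranks occurring in such an [F] are
   bounded, so one [n] captures all of them. *)
apply: ge_ereal_sup => _ [F [finF FI] <-].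
have [k LkI] := LI.
have [n Fn] : exists n, forall J, F J -> (exists j, is_rank L J j) -> X n k I J.
  have /choice[r rP] : forall J, exists n : nat, forall j, is_rank L J j -> (j < k + n%:Z)%R.
    move=> J; have [[j Jj]|nJ] := pselect (exists j, is_rank L J j).
      exists (`|j - k|.+1)%N => j' /(rank_uniq Jj) <-.
      rewrite -ltrBlDl; apply: le_lt_trans (ler_norm _) _.
      by rewrite -abszE ltz_nat.
    by exists 0%N => j Jj; exfalso; apply: nJ; exists j.
  have [s Fs] := iffLR (finite_seqP F) finF.
  exists (\max_(J <- s) r J)%N => J FJ [j Jj]; split; first exact: (FI _ FJ).2.
  exists j; split=> //; apply: lt_le_trans (rP _ _ Jj) _.
  rewrite lerD2l lez_nat; apply: leq_bigmax_seq => //.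
  by move: FJ; rewrite Fs.
apply: le_trans (XB n k I LkI); apply: esum_ge.
exists (F `&` X n k I).
  by split; [exact: finite_setIl | move=> J []].
apply: le_trans; last first.
  by rewrite fsbig_mkcondr.
apply: lee_fsum => // J FJ; case: ifPn => // /negP JX.
rewrite vrl//; first by case: (FI _ FJ).
by move=> j Jj; apply: JX; apply/mem_set/Fn => //; exists j.
Qed.

End lattice.

(** * Averages and martingale differences *)

Section martingale_difference.
Context {R : realType} (L : int -> set (set R)) (latL : is_lattice L) (g : R -> R).
Local Notation mu := (@lebesgue_measure R).
Implicit Types (I J K : set R) (k : int).

Lemma len_ge0 I : 0 <= len I.
Proof. exact/fine_ge0/measure_ge0. Qed.

Lemma len_gt0 I : inL L I -> 0 < len I.
Proof. by move=> /(inL_nd latL) /nd_intervalP[]. Qed.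

Lemma measurable_inL I : inL L I -> measurable I.
Proof. by move=> /(inL_nd latL) /nd_intervalP[]. Qed.

Lemma mu_inL I : inL L I -> mu I = (len I)%:E.
Proof. by move=> /(inL_nd latL) /nd_intervalP[]. Qed.

Lemma sum_child_indic J k (F : set R -> R) K x : is_rank L J k -> child L J K -> K x ->
  \sum_(M \in child L J) F M * \1_M x = F K.
Proof.
move=> Jk cK Kx; rewrite (fsbigD1 K)//=; last exact: (finite_child latL Jk).
rewrite indicE mem_set// mulr1 fsbig1 ?addr0// => M [cM MK].
rewrite indicE memNset ?mulr0// => Mx; apply: MK.
exact: child_eq latL _ _ Jk _ _ _ cM cK Mx Kx.
Qed.

Lemma sum_child_indic_out J k (F : set R -> R) x : is_rank L J k -> ~ J x ->
  \sum_(M \in child L J) F M * \1_M x = 0.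
Proof.
move=> Jk nJx; apply: fsbig1 => M cM; rewrite indicE memNset ?mulr0// => Mx.
by apply: nJx; exact: (child_sub Jk cM).
Qed.

Lemma Delta_rankless J : (forall k, ~ is_rank L J k) -> Delta L g J = cst 0.
Proof.
by move=> Jk; apply/funext => x; rewrite /Delta child_rankless// fsbig_set1 addNr.
Qed.

Lemma Delta_child J k K x : is_rank L J k -> child L J K -> K x ->
  Delta L g J x = avg g K - avg g J.
Proof.
move=> Jk cK Kx; rewrite /Delta /EI (sum_child_indic (avg g) Jk cK Kx).
by rewrite indicE mem_set ?mulr1 1?addrC//; exact: (child_sub Jk cK).
Qed.

Lemma Delta_out J k x : is_rank L J k -> ~ J x -> Delta L g J x = 0.
Proof.
move=> Jk nJx; rewrite /Delta /EI (sum_child_indic_out _ Jk nJx).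
by rewrite indicE memNset// mulr0 addr0 oppr0.
Qed.

Lemma in_child J k x : is_rank L J k -> J x -> exists2 K, child L J K & K x.
Proof. by move=> Jk; rewrite -{1}(bigcup_child latL Jk) => -[K]; exists K. Qed.

Lemma Delta_le J c x : 0 <= c ->
  (forall k K, is_rank L J k -> child L J K -> `|avg g K - avg g J| <= c) ->
  `|Delta L g J x| <= c.
Proof.
move=> c0 h; have [[k Jk]|nJ] := pselect (exists k, is_rank L J k); last first.
  by rewrite Delta_rankless ?normr0// => k Jk; apply: nJ; exists k.
have [Jx|nJx] := pselect (J x); last by rewrite (Delta_out Jk nJx) normr0.
have [K cK Kx] := in_child Jk Jx.
by rewrite (Delta_child Jk cK Kx); exact: h Jk cK.
Qed.

(** The children are disjoint, so squaring produces no cross terms. The right-hand side is an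
    unordered sum of scaled indicators, ready for measurability and termwise integration. *)
Lemma sqr_DeltaE J k x : is_rank L J k ->
  (((Delta L g J x) ^+ 2)%:E =
   \esum_(K in child L J) (((avg g K - avg g J) ^+ 2) * \1_K x)%:E)%E.
Proof.
move=> Jk; have fc := finite_child latL Jk.
rewrite esum_fset//; last first.
  by move=> K _; rewrite lee_fin mulr_ge0 ?sqr_ge0.
rewrite fsumEFin//; congr EFin.
have [Jx|nJx] := pselect (J x); last first.
  by rewrite (Delta_out Jk nJx) (sum_child_indic_out _ Jk nJx) expr0n.
have [K cK Kx] := in_child Jk Jx.
by rewrite (Delta_child Jk cK Kx) (sum_child_indic _ Jk cK Kx).
Qed.

Lemma countable_child J k : is_rank L J k -> countable (child L J).
Proof. by move=> Jk; exact/finite_set_countable/(finite_child latL Jk). Qed.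

Lemma measurable_sqr_Delta D J : measurable D -> inL L J ->
  measurable_fun D (fun x => ((Delta L g J x) ^+ 2)%:E).
Proof.
move=> mD LJ; have [[k Jk]|nJ] := pselect (exists k, is_rank L J k); last first.
  have -> : Delta L g J = cst 0 by apply: Delta_rankless => k Jk; apply: nJ; exists k.
  exact: (measurable_cst ((0 : R) ^+ 2)%:E).
under eq_fun do rewrite (sqr_DeltaE _ Jk).
apply: ge0_measurable_esum; [exact: countable_child Jk| |].
- move=> K cK; apply/measurable_EFinP; apply: measurable_funM => //.
  by apply: measurable_indic; exact: (measurable_inL (child_inL Jk cK)).
- by move=> K x; rewrite lee_fin mulr_ge0 ?sqr_ge0.
Qed.

(** Any [D] containing [J] gives the same value because the difference vanishes outside [J]; the
    whole line is the choice made later. *)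
Lemma integral_sqr_Delta D J k : measurable D -> J `<=` D -> is_rank L J k ->
  (\int[mu]_(x in D) ((Delta L g J x) ^+ 2)%:E =
   (\sum_(K \in child L J) len K * (avg g K - avg g J) ^+ 2)%:E)%E.
Proof.
move=> mD JD Jk; under eq_integral do rewrite (sqr_DeltaE _ Jk).
have mK K : child L J K -> measurable K.
  by move=> cK; exact: (measurable_inL (child_inL Jk cK)).
rewrite ge0_integral_esum//.
- rewrite esum_fset; [|exact: (finite_child latL Jk)|].
    rewrite -fsumEFin; last exact: (finite_child latL Jk).
    apply: eq_fsbigr => K /set_mem cK; under eq_integral do rewrite EFinM.
    rewrite ge0_integralZl//; last 2 first.
    + by apply/measurable_EFinP; apply: measurable_indic; exact: mK.
    + by rewrite lee_fin sqr_ge0.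
    rewrite integral_indic//; last exact: mK.
    have KD : K `&` D = K.
      by apply/setIidPl/(subset_trans _ JD); exact: (child_sub Jk cK).
    rewrite KD [X in (_ * X)%E](_ : _ = (len K)%:E); first by rewrite -EFinM mulrC.
    exact: (mu_inL (child_inL Jk cK)).
  by move=> K _; apply: integral_ge0 => x _; rewrite lee_fin mulr_ge0 ?sqr_ge0.
- exact: countable_child Jk.
- move=> K cK; apply/measurable_EFinP; apply: measurable_funM => //.
  by apply: measurable_indic; exact: mK.
- by move=> K x; rewrite lee_fin mulr_ge0 ?sqr_ge0.
Qed.

End martingale_difference.

(** * Balayage of nonnegative coefficients *)

Section mass_tail.
Context {R : realType} (L : int -> set (set R)) (latL : is_lattice L).
Local Notation mu := (@lebesgue_measure R).
Implicit Types (I J K : set R) (k : int) (b : set R -> R).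

Definition mass b I : \bar R := \esum_(J in under L I) (b J)%:E.
(** The constant value on [I] of the part of the balayage coming from strictly larger intervals; the
    indicators are dropped since each equals one on [I]. *)
Definition tail b I : \bar R := \esum_(J in above L I) ((len J)^-1 * b J)%:E.
Definition psum b x : \bar R := \esum_(J in inL L) ((len J)^-1 * b J * \1_J x)%:E.

Section nonneg.
Context b (b0 : forall I, 0 <= b I).

Lemma mass_ge0 I : (0 <= mass b I)%E.
Proof. by apply: esum_ge0 => J _; rewrite lee_fin. Qed.

Lemma tail_ge0 I : (0 <= tail b I)%E.
Proof. by apply: esum_ge0 => J _; rewrite lee_fin mulr_ge0 ?invr_ge0 ?len_ge0. Qed.

Lemma psum_term_ge0 J x : (0 <= ((len J)^-1 * b J * \1_J x)%:E)%E.
Proof. by rewrite lee_fin !mulr_ge0 ?invr_ge0 ?len_ge0. Qed.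

Lemma psum_ge0 x : (0 <= psum b x)%E.
Proof. by apply: esum_ge0 => J _; exact: psum_term_ge0. Qed.

(** A lattice interval containing [x] meets [I], hence is below or above it by nestedness; all
    others contribute zero at [x]. *)
Lemma psum_split I x : inL L I -> I x ->
  (psum b x = tail b I + \esum_(J in under L I) ((len J)^-1 * b J * \1_J x)%:E)%E.
Proof.
move=> LI Ix; rewrite /psum (esumID (under L I)); last first.
  by move=> J _; exact: psum_term_ge0.
rewrite addeC; congr (_ + _)%E; last by congr esum; apply/seteqP; split=> J; [case|case].
rewrite /tail esum_mkcond [RHS]esum_mkcond; apply: eq_esum => J _.
have [/set_mem[LJ IJ JI]|aJ] := boolP (J \in above L I).
  rewrite mem_set; first by rewrite indicE mem_set ?mulr1//; exact: IJ.
  by split=> // -[_ JI']; apply: JI; apply/seteqP.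
case: ifPn => // /set_mem[LJ uJ]; rewrite indicE.
have [/set_mem Jx|_] := boolP (x \in J); last by rewrite mulr0.
exfalso; have [IJ|JI] := inL_nested latL LI LJ Ix Jx; last by apply: uJ.
move/negP: aJ; apply; apply/mem_set; split=> // JI.
by apply: uJ; rewrite JI; split=> //; rewrite -JI.
Qed.

Lemma measurable_psum_term I J : inL L J ->
  measurable_fun I (fun x : R => ((len J)^-1 * b J * \1_J x)%:E).
Proof.
move=> LJ; apply/measurable_EFinP; apply: measurable_funM => //.
by apply: measurable_indic; exact: (measurable_inL latL).
Qed.

Lemma measurable_psum_under I : inL L I ->
  measurable_fun I (fun x => \esum_(J in under L I) ((len J)^-1 * b J * \1_J x)%:E)%E.
Proof.
move=> LI; apply: ge0_measurable_esum; first exact: (countable_under latL).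
  by move=> J [LJ _]; exact: measurable_psum_term.
by move=> J x; exact: psum_term_ge0.
Qed.

Lemma measurable_psum I : inL L I -> measurable_fun I (psum b).
Proof.
move=> LI; apply: (eq_measurable_fun
  (fun x => tail b I + \esum_(J in under L I) ((len J)^-1 * b J * \1_J x)%:E)%E).
  by move=> x /set_mem Ix; rewrite (psum_split LI Ix).
by apply: emeasurable_funD; [exact: measurable_cst | exact: measurable_psum_under].
Qed.

(** On [I] the tail is constant, and an interval [J] inside [I] contributes [b J], because
    integrating its indicator cancels the factor [(len J)^-1]. *)
Lemma integral_psum I : inL L I ->
  (\int[mu]_(x in I) psum b x = tail b I * (len I)%:E + mass b I)%E.
Proof.
move=> LI; have mI := measurable_inL latL LI.
under eq_integral => x /set_mem Ix do rewrite (psum_split LI Ix).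
rewrite ge0_integralD//; last 3 first.
- by move=> x _; exact: tail_ge0.
- by move=> x _; apply: esum_ge0 => J _; exact: psum_term_ge0.
- exact: measurable_psum_under.
rewrite integral_cst//; congr (_ * _ + _)%E; first exact: (mu_inL latL).
rewrite ge0_integral_esum//.
- apply: eq_esum => J [LJ JI]; under eq_integral do rewrite EFinM.
  rewrite ge0_integralZl//; last 2 first.
  + by apply/measurable_EFinP; apply: measurable_indic; exact: (measurable_inL latL).
  + by rewrite lee_fin mulr_ge0 ?invr_ge0 ?len_ge0.
  rewrite integral_indic//; last exact: (measurable_inL latL).
  rewrite (iffRL (setIidPl _ _) JI) [X in (_ * X)%E](_ : _ = (len J)%:E); last first.
    exact: (mu_inL latL).
  rewrite -EFinM mulrAC mulVf ?mul1r//.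
  by rewrite gt_eqF// (len_gt0 latL).
- exact: (countable_under latL).
- by move=> J [LJ _]; exact: measurable_psum_term.
- by move=> J x; exact: psum_term_ge0.
Qed.

Context I (LI : inL L I) (mfin : (mass b I < +oo)%E) (tfin : (tail b I < +oo)%E).

Lemma massE : mass b I = (fine (mass b I))%:E.
Proof. by rewrite fineK// ge0_fin_numE// mass_ge0. Qed.

Lemma tailE : tail b I = (fine (tail b I))%:E.
Proof. by rewrite fineK// ge0_fin_numE// tail_ge0. Qed.

Lemma integrable_psum : mu.-integrable I (psum b).
Proof.
apply/integrableP; split; first exact: measurable_psum.
under eq_integral do rewrite gee0_abs ?psum_ge0//.
by rewrite integral_psum// tailE massE -EFinM -EFinD ltry.
Qed.

Lemma measurable_fine_psum : measurable_fun I (EFin \o (fine \o psum b)).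
Proof.
apply/measurable_EFinP; apply: (measurableT_comp (fine_measurable measurableT)).
exact: measurable_psum.
Qed.

(** Integrability forces finiteness almost everywhere, so replacing infinite values by zero through
    [fine] leaves integrals unchanged. *)
Lemma ae_fine_psum : ae_eq mu I (EFin \o (fine \o psum b)) (psum b).
Proof.
have := @integrable_ae _ _ _ mu I (measurable_inL latL LI) (psum b) integrable_psum.
by apply: filterS => x h /h/fineK.
Qed.

Lemma integral_fine_psum :
  (\int[mu]_(x in I) (fine (psum b x))%:E =
   (fine (tail b I) * len I + fine (mass b I))%:E)%E.
Proof.
rewrite EFinD EFinM -massE -tailE -integral_psum//.
apply: ae_eq_integral; [exact: (measurable_inL latL) | exact: measurable_fine_psum
  | exact: measurable_psum | exact: ae_fine_psum].
Qed.

Lemma integrable_fine_psum : mu.-integrable I (EFin \o (fine \o psum b)).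
Proof.
apply/integrableP; split; first exact: measurable_fine_psum.
under eq_integral => x _ do rewrite gee0_abs ?lee_fin ?fine_ge0 ?psum_ge0//.
by rewrite integral_fine_psum ltry.
Qed.

End nonneg.

Lemma mass_child b I k : (forall I, 0 <= b I) -> is_rank L I k -> (mass b I < +oo)%E ->
  fine (mass b I) = b I + \sum_(K \in child L I) fine (mass b K).
Proof.
move=> b0 Ik; rewrite /mass (esum_under_ranked latL Ik)//.
have s0 : (0 <= \sum_(K \in child L I) mass b K)%E.
  by rewrite fsume_ge0// => K _; exact: mass_ge0.
move=> fin; have sfin : (\sum_(K \in child L I) mass b K < +oo)%E.
  by apply: le_lt_trans fin; rewrite leeDr ?lee_fin.
have fc := finite_child latL Ik.
have Kfin K : child L I K -> mass b K = (fine (mass b K))%:E.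
  move=> cK; rewrite fineK// ge0_fin_numE ?mass_ge0//; apply: le_lt_trans sfin.
  rewrite (fsbigD1 K)//= leeDl// fsume_ge0// => J _; exact: mass_ge0.
rewrite -/(mass b _) (eq_fsbigr (fun K => (fine (mass b K))%:E)).
  by rewrite fsumEFin.
by move=> K /set_mem /Kfin.
Qed.

Lemma tail_child b I k K : (forall I, 0 <= b I) -> is_rank L I k -> child L I K ->
  (tail b I < +oo)%E ->
  fine (tail b K) = (len I)^-1 * b I + fine (tail b I).
Proof.
move=> b0 Ik cK tfin; rewrite /tail (above_child latL Ik cK) esum_setU; last 2 first.
- exact: above_notin.
- by move=> J; rewrite lee_fin mulr_ge0 ?invr_ge0 ?len_ge0.
rewrite esum_set1 ?lee_fin ?mulr_ge0 ?invr_ge0 ?len_ge0//.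
by rewrite fineD// ge0_fin_numE// tail_ge0.
Qed.

Lemma le_mass b c I : (forall J, b J <= c J) -> (mass b I <= mass c I)%E.
Proof. by move=> bc; apply: le_esum => J _; rewrite lee_fin. Qed.

Lemma le_tail b c I : (forall J, b J <= c J) -> (tail b I <= tail c I)%E.
Proof.
by move=> bc; apply: le_esum => J _; rewrite lee_fin ler_wpM2l ?invr_ge0 ?len_ge0.
Qed.

End mass_tail.

(** * The balayage *)

Section balayage_bmo.
Context {R : realType} (L : int -> set (set R)) (latL : is_lattice L).
Context (a : set R -> R) (C : R).
Local Notation mu := (@lebesgue_measure R).
Local Notation absa := (fun I => `|a I|).
Local Notation apos := (fun I => Num.max (a I) 0).
Local Notation aneg := (fun I => Num.max (- a I) 0).
Local Notation g := (balayage L a).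
Implicit Types (I J K : set R) (k : int).
Hypothesis carlC : carleson_bound L absa C.
Hypothesis tail_lty : forall I, inL L I -> (tail L absa I < +oo)%E.

Let absa0 I : 0 <= absa I. Proof. exact: normr_ge0. Qed.
Let apos0 I : 0 <= apos I. Proof. by rewrite le_max lexx orbT. Qed.
Let aneg0 I : 0 <= aneg I. Proof. by rewrite le_max lexx orbT. Qed.
Let apos_le I : apos I <= absa I. Proof. by rewrite ge_max ler_norm normr_ge0. Qed.
Let aneg_le I : aneg I <= absa I.
Proof. by rewrite ge_max -normrN ler_norm normr_ge0. Qed.
Let apos_sub I : apos I - aneg I = a I.
Proof. by rewrite /= !maxEle; case: (leP (a I) 0) => ?; case: (leP (- a I) 0) => ?; lra. Qed.
Let apos_add I : absa I = apos I + aneg I.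
Proof.
by have [a0|a0] := ger0P (a I); rewrite /= !maxEle;
  case: (leP (a I) 0) => ?; case: (leP (- a I) 0) => ?; lra.
Qed.

Lemma carleson_mass I : inL L I -> (mass L absa I <= (C * len I)%:E)%E.
Proof.
move=> LI; have := carlC (or_introl LI).
by rewrite -/(under L I) -/(mass L absa I) lee_pdivrMl ?(len_gt0 latL)// -EFinM mulrC.
Qed.

Lemma mass_lty I : inL L I -> (mass L absa I < +oo)%E.
Proof. by move=> /carleson_mass/le_lt_trans; apply; rewrite ltry. Qed.

Let apos_mass I (LI : inL L I) : (mass L apos I < +oo)%E.
Proof. exact: le_lt_trans (le_mass _ _ apos_le) (mass_lty LI). Qed.
Let aneg_mass I (LI : inL L I) : (mass L aneg I < +oo)%E.
Proof. exact: le_lt_trans (le_mass _ _ aneg_le) (mass_lty LI). Qed.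
Let apos_tail I (LI : inL L I) : (tail L apos I < +oo)%E.
Proof. exact: le_lt_trans (le_tail _ _ apos_le) (tail_lty LI). Qed.
Let aneg_tail I (LI : inL L I) : (tail L aneg I < +oo)%E.
Proof. exact: le_lt_trans (le_tail _ _ aneg_le) (tail_lty LI). Qed.

(** The signed sum [s_I], split into positive and negative parts, which are finite by the Carleson
    bound; [stail] is the corresponding constant contributed by the larger intervals. *)
Definition smass I : R := fine (mass L apos I) - fine (mass L aneg I).
Definition stail I : R := fine (tail L apos I) - fine (tail L aneg I).
Definition amass I : R := fine (mass L absa I).

Lemma amass_ge0 I : 0 <= amass I.
Proof. by apply/fine_ge0/mass_ge0. Qed.

Lemma amass_le I : inL L I -> amass I <= C * len I.
Proof.
by move=> LI; have := carleson_mass LI; rewrite (massE absa0 (mass_lty LI)) lee_fin.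
Qed.

(** [C] is an arbitrary real here; its sign comes from bounding a nonnegative mass by [C] times a
    positive length. *)
Lemma carleson_ge0 I : inL L I -> 0 <= C.
Proof.
move=> LI; have := le_trans (amass_ge0 I) (amass_le LI).
by rewrite pmulr_lge0 ?(len_gt0 latL).
Qed.

Lemma smass_le I : inL L I -> `|smass I| <= amass I.
Proof.
move=> LI; suff -> : amass I = fine (mass L apos I) + fine (mass L aneg I).
  have p0 : 0 <= fine (mass L apos I) by apply/fine_ge0/mass_ge0.
  have n0 : 0 <= fine (mass L aneg I) by apply/fine_ge0/mass_ge0.
  by rewrite /smass ler_norml; apply/andP; split; lra.
rewrite -fineD ?ge0_fin_numE ?mass_ge0 ?apos_mass ?aneg_mass//.
rewrite -esumD; [|by move=> J _; rewrite lee_fin|by move=> J _; rewrite lee_fin].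
by congr fine; apply: eq_esum => J _; rewrite -EFinD -apos_add.
Qed.

Lemma avg_balayage I : inL L I -> avg g I = stail I + (len I)^-1 * smass I.
Proof.
move=> LI; have l0 := len_gt0 latL LI.
rewrite /avg /balayage; under eq_integral do rewrite EFinB.
rewrite (integralB_EFin (mu := mu) (measurable_inL latL LI)
  (integrable_fine_psum latL apos0 LI (apos_mass LI) (apos_tail LI))
  (integrable_fine_psum latL aneg0 LI (aneg_mass LI) (aneg_tail LI))).
rewrite (integral_fine_psum latL apos0 LI (apos_mass LI) (apos_tail LI)).
rewrite (integral_fine_psum latL aneg0 LI (aneg_mass LI) (aneg_tail LI)).
rewrite -EFinB/= /stail /smass; field.
by rewrite gt_eqF.
Qed.

(** * Averages over an interval and over its children *)

Section ranked.
Context I k (Ik : is_rank L I k).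
Let LI : inL L I := rank_inL Ik.

Lemma smass_child : smass I = a I + \sum_(K \in child L I) smass K.
Proof.
have fc := finite_child latL Ik.
rewrite /smass (mass_child latL apos0 Ik (apos_mass LI)).
rewrite (mass_child latL aneg0 Ik (aneg_mass LI)) -[in RHS](apos_sub I).
rewrite opprD addrACA; congr (_ + _).
by rewrite -mulN1r mulr_fsumr -fsbig_split//; apply: eq_fsbigr => K _; rewrite /= mulN1r.
Qed.

Lemma amass_child : amass I = `|a I| + \sum_(K \in child L I) amass K.
Proof. exact: mass_child absa0 Ik (mass_lty LI). Qed.

(** Passing to a child adds [a I / len I] to the constant part; the contribution of the intervals
    above [I] cancels. *)
Lemma avg_child K : child L I K ->
  avg g K - avg g I =
    (a I - smass I) / len I + (len K)^-1 * smass K.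
Proof.
move=> cK; rewrite (avg_balayage (child_inL Ik cK)) avg_balayage//.
rewrite /stail (tail_child latL apos0 Ik cK (apos_tail LI)).
rewrite (tail_child latL aneg0 Ik cK (aneg_tail LI)) -[in RHS](apos_sub I).
by lra.
Qed.

Lemma avg_child_le K : child L I K -> `|avg g K - avg g I| <= 2 * C.
Proof.
move=> cK; have LK := child_inL Ik cK.
have lI := len_gt0 latL LI; have lK := len_gt0 latL LK.
rewrite avg_child// mulr_natl mulr2n (le_trans (ler_normD _ _))// lerD//.
  rewrite normrM normfV (gtr0_norm lI) ler_pdivrMr//.
  (* [smass I - a I] is the sum of the signed masses of the children, hence bounded by the sum of
     their [amass], which is [amass I] minus a nonnegative number. *)
  apply: le_trans (amass_le LI); rewrite distrC smass_child addrC addKr.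
  have fc := finite_child latL Ik.
  rewrite amass_child; apply: (@le_trans _ _ (\sum_(J \in child L I) amass J)).
    rewrite !fsbig_finite//=; apply: le_trans (ler_norm_sum _ _ _) _.
    rewrite big_seq [leRHS]big_seq; apply: ler_sum => J.
    rewrite in_fset_set// => /set_mem cJ.
    exact: (smass_le (child_inL Ik cJ)).
  by rewrite lerDr.
rewrite normrM normfV (gtr0_norm lK) ler_pdivrMl// mulrC.
exact: le_trans (smass_le LK) (amass_le LK).
Qed.

End ranked.

(** The term in [smass I ^+ 2] absorbs the squared averages of the children, [2 * C * amass I] pays
    for the cross term between [smass I] and [a I], and [C ^+ 2 * len I] keeps the whole
    nonnegative. *)
Definition bellman I : R :=
  C ^+ 2 * len I - (len I)^-1 * smass I ^+ 2 + 2 * C * amass I.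

Lemma smass_sqr_le I : inL L I -> (len I)^-1 * smass I ^+ 2 <= C ^+ 2 * len I.
Proof.
move=> LI; have l0 := len_gt0 latL LI.
rewrite ler_pdivrMl// mulrCA -expr2 -exprMn -real_normK ?num_real//.
rewrite ler_sqr ?nnegrE ?mulr_ge0 ?(carleson_ge0 LI) ?(ltW l0)//.
exact: le_trans (smass_le LI) (amass_le LI).
Qed.

Lemma bellman_ge0 I : inL L I -> 0 <= bellman I.
Proof.
move=> LI; rewrite addr_ge0 ?subr_ge0 ?smass_sqr_le//.
by rewrite !mulr_ge0 ?(carleson_ge0 LI) ?amass_ge0.
Qed.

(** The constant 3 is [1 + 2]: the negative term is dropped and [amass I] is at most [C * len I]. *)
Lemma bellman_le I : inL L I -> bellman I <= 3 * C ^+ 2 * len I.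
Proof.
move=> LI; have C0 := carleson_ge0 LI.
have : 0 <= (len I)^-1 * smass I ^+ 2 by rewrite mulr_ge0 ?sqr_ge0 ?invr_ge0 ?len_ge0.
have : C * amass I <= C * (C * len I) by rewrite ler_wpM2l ?amass_le.
rewrite /bellman expr2; lra.
Qed.

(* Since the children's lengths add up to [len I] and their signed masses to
   [smass I - a I], the gap between the two sides equals
   [(2 (C |I| |a_I| - s_I a_I) + a_I^2) / |I|]. *)
Lemma bellman_step I k : is_rank L I k ->
  \sum_(K \in child L I) len K * (avg g K - avg g I) ^+ 2 +
  \sum_(K \in child L I) bellman K <= bellman I.
Proof.
move=> Ik; have LI := rank_inL Ik; have l0 := len_gt0 latL LI.
have fc := finite_child latL Ik.
set e := (a I - smass I) / len I.
rewrite -fsbig_split//=.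
(* The terms [smass K ^+ 2 / len K] cancel between the two sums, so the summand becomes linear in
   [len K], [smass K] and [amass K], whose sums over the children are known. *)
rewrite (eq_fsbigr (fun K => (e ^+ 2 + C ^+ 2) * len K + (2 * e * smass K + 2 * C * amass K))).
  rewrite !fsbig_split//= -!mulr_fsumr -(len_child latL Ik).
  have := smass_child Ik; have := amass_child Ik.
  move: (\sum_(K \in child L I) amass K) => M aM.
  move: (\sum_(K \in child L I) smass K) => S sS.
  have {}aM : M = amass I - `|a I| by rewrite aM; lra.
  have {}sS : S = smass I - a I by rewrite sS; lra.
  have el : e * len I = a I - smass I by rewrite /e mulfVK// gt_eqF.
  have al : smass I * a I <= C * len I * `|a I|.
    apply: le_trans (ler_norm _) _; rewrite normrM ler_wpM2r//.
    exact: le_trans (smass_le LI) (amass_le LI).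
  rewrite /bellman aM sS -subr_ge0.
  have -> : C ^+ 2 * len I - (len I)^-1 * smass I ^+ 2 + 2 * C * amass I -
     ((e ^+ 2 + C ^+ 2) * len I +
      (2 * e * (smass I - a I) + 2 * C * (amass I - `|a I|))) =
     (len I)^-1 * (2 * (C * len I * `|a I| - smass I * a I) + a I ^+ 2).
    by rewrite /e; field; rewrite gt_eqF.
  rewrite mulr_ge0 ?invr_ge0 ?(ltW l0)// addr_ge0 ?sqr_ge0//.
  by rewrite mulr_ge0// subr_ge0.
move=> K /set_mem cK; rewrite (avg_child Ik cK) -/e /bellman.
have : len K != 0 by rewrite gt_eqF// (len_gt0 latL (child_inL Ik cK)).
by move=> lK; field.
Qed.

(** * The two quantities in the BMO norm *)

Lemma balayage_C2 : (bmo_C2 L g <= (2 * C)%:E)%E.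
Proof.
apply: ge_ereal_sup => _ [I LI <-]; apply: ess_sup_ler => x; rewrite lee_fin.
apply: (Delta_le latL); first by rewrite mulr_ge0 ?(carleson_ge0 LI).
by move=> k K Ik cK; exact: (avg_child_le Ik cK).
Qed.

Lemma square_function_le I : inL L I ->
  (\int[mu]_(x in I) (\esum_(J in under L I) ((Delta L g J x) ^+ 2)%:E) <=
   (3 * C ^+ 2 * len I)%:E)%E.
Proof.
move=> LI; have mI := measurable_inL latL LI.
rewrite ge0_integral_esum//; last 3 first.
- exact: (countable_under latL).
- by move=> J [LJ _]; exact: (measurable_sqr_Delta latL).
- by move=> J x; rewrite lee_fin sqr_ge0.
(* Integrating over the whole line makes [v] a function of [J] alone, as the Bellman function
   principle requires. *)
pose v J := (\int[mu]_x ((Delta L g J x) ^+ 2)%:E)%E.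
apply: (@le_trans _ _ (\esum_(J in under L I) v J)%E).
  apply: le_esum => J [LJ _]; apply: ge0_subset_integral => //.
    exact: (measurable_sqr_Delta latL).
  by move=> x _; rewrite lee_fin sqr_ge0.
apply: (@le_trans _ _ (bellman I)%:E); last by rewrite lee_fin bellman_le.
apply: (esum_under_le latL (B := fun J => (bellman J)%:E)) => //.
- by move=> J; apply: integral_ge0 => x _; rewrite lee_fin sqr_ge0.
- by move=> J LJ; rewrite lee_fin bellman_ge0.
- move=> J LJ nJ; rewrite /v Delta_rankless//.
  by under eq_integral do rewrite expr0n; rewrite integral0.
- move=> J k Jk; rewrite /v (integral_sqr_Delta latL _ measurableT _ Jk)//.
  rewrite fsumEFin; last exact: (finite_child latL Jk).
  by rewrite -EFinD lee_fin; exact: bellman_step Jk.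
Qed.

(** The square function bound gives [3 * C ^+ 2] after division by [len I], which is at most
    [(2 * C) ^+ 2]. *)
Lemma balayage_C1 : (bmo_C1 L g <= (2 * C)%:E)%E.
Proof.
apply: ge_ereal_sup => _ [I LI <-]; have C0 := carleson_ge0 LI.
have l0 := len_gt0 latL LI.
have -> : (2 * C)%:E = sqrte ((2 * C)%:E ^+ 2).
  by rewrite sqrte_sqr gee0_abs// lee_fin mulr_ge0.
rewrite lee_sqrt ?sqre_ge0// lee_pdivrMl// -EFin_expe -EFinM.
apply: le_trans (square_function_le LI) _; rewrite lee_fin mulrC.
by rewrite ler_pM2l// exprMn; have := sqr_ge0 C; lra.
Qed.

End balayage_bmo.

(** * Passage to the optimal Carleson constant *)

Lemma carleson_bound_Carl (R : realType) (L : int -> set (set R)) (b : set R -> R) :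
  carleson_seq L b -> carleson_bound L b (Carl L b).
Proof.
move=> [_ [C0 CC0]] I hI; set y := (_ * _)%E.
have hy C : 0 < C /\ carleson_bound L b C -> (y <= C%:E)%E by move=> [_ /(_ _ hI)].
(* For fixed [I] the left-hand side [y] does not depend on the constant, so a real [y] is a lower
   bound of the admissible constants and hence at most their infimum; one admissible constant
   excludes [+oo]. *)
have [[r yr]|[->|yy]] : (exists r, y = r%:E) \/ y = -oo%E \/ y = +oo%E.
- by case: y {hy} => [r| |]; [left; exists r|right; right|right; left].
- rewrite yr lee_fin; apply: lb_le_inf; first by exists C0.
  by move=> C /hy; rewrite yr lee_fin.
- by rewrite leNye.
- by have := hy _ CC0; rewrite yy leye_eq.
Qed.

(** An interval of the lattice has positive measure, so it contains a point where the balayage of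
    the absolute values is finite, and that value dominates the tail. *)
Lemma tail_lty_ae (R : realType) (L : int -> set (set R)) (a : set R -> R) I :
  is_lattice L ->
  (\forall x \ae (@lebesgue_measure R), (balayage_abs L a x < +oo)%E) ->
  inL L I -> (tail L (fun J => `|a J|%R) I < +oo)%E.
Proof.
move=> latL [N [mN N0 aN]] LI.
have [x Ix xfin] : exists2 x, I x & (balayage_abs L a x < +oo)%E.
  apply: contrapT => nx; have : (lebesgue_measure I <= lebesgue_measure N)%E.
    apply: le_measure; rewrite ?inE//; first exact: (measurable_inL latL).
    by move=> x Ix; apply: aN; apply: contra_not nx => xfin; exists x.
  by rewrite N0 (mu_inL latL LI) lee_fin leNgt (len_gt0 latL LI).
apply: le_lt_trans xfin; rewrite [leRHS](@psum_split _ _ latL (fun J => `|a J|) _ _ _ LI Ix)//.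
by rewrite leeDl// esum_ge0// => J _; exact: (@psum_term_ge0 _ (fun J => `|a J|)).
Qed.

Theorem theorem2 (R : realType) (L : int -> set (set R)) (a : set R -> R) :
  is_lattice L ->
  carleson_seq L (fun I => `|a I|) ->
  (\forall x \ae (@lebesgue_measure R), (balayage_abs L a x < +oo)%E) ->
  loc_integrable (balayage_abs L a) ->
  in_BMO L (balayage L a) /\
  (bmo_norm L (balayage L a) <= (2 * Carl L (fun I => `|a I|))%:E)%E.
Proof.
move=> latL /carleson_bound_Carl carlC finae _.
have tl I (LI : inL L I) := tail_lty_ae latL finae LI.
have C1 := balayage_C1 latL carlC tl; have C2 := balayage_C2 latL carlC tl.
split; last by rewrite /bmo_norm ge_max C1.
by split; [apply: le_lt_trans C1 _ | apply: le_lt_trans C2 _]; exact: ltry.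
Qed.
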